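(* Let $G$ be a transitive imprimitive permutation group on a finite set $\Omega$ which is pre-synchronizing. Then $|\Omega|=4$ and $G$ is the Klein group $C_2\times C_2$ in its regular action of degree $4$ (up to permutation isomorphism).
   Context: A permutation group on $\Omega$ is a subgroup of $\mathrm{Sym}(\Omega)$, acting on the right. A partition of $\Omega$ is $G$-invariant if every $g\in G$ maps each part onto a part. A partition is trivial if it is the partition into singletons or the partition with a single part. A transitive group $G$ is imprimitive if it preserves some non-trivial partition of $\Omega$. A section (transversal) of a partition is a subset meeting each part in exactly one point. A partition $\Pi$ of $\Omega$ is section-regular for $G$ if there is a subset $A\subseteq\Omega$ such that $Ag$ is a section of $\Pi$ for all $g\in G$. A transitive permutation group $G$ on $\Omega$ is pre-synchronizing if every section-regular partition for $G$ is $G$-invariant. *)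

(* Defs.v *)
From mathcomp Require Import all_boot all_fingroup ssralg zmodp primitive_action.

Set Implicit Arguments.
Unset Strict Implicit.
Unset Printing Implicit Defensive.

Import GroupScope.

Section PermutationGroups.

Variables (T : finType) (G : {group {perm T}}).
Implicit Types (P : {set {set T}}) (A : {set T}).

Definition transitive_group : bool := [transitive G, on [set: T] | 'P].

Definition trivial_partition P : bool :=
  (P == [set [set x] | x : T]) || (P == [set [set: T]]).

Definition invariant_partition P : bool := [acts G, on P | 'P^*].

Definition imprimitive_group : Prop :=
  transitive_group /\
  exists P, [/\ partition P [set: T], invariant_partition P
              & ~~ trivial_partition P].

Definition section_regular P : Prop :=
  exists A, forall g, g \in G -> is_transversal (g @: A) P [set: T].

Definition pre_synchronizing : Prop :=
  transitive_group /\
  forall P, partition P [set: T] -> section_regular P -> invariant_partition P.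

Lemma nontrivial_partitionE P :
  partition P [set: T] -> 0 < #|T| ->
  ~~ trivial_partition P = (1 < #|P| < #|[set: T]|).
Proof.
move=> partP T_gt0; have /and3P[/eqP covP trivP P0] := partP.
have Bgt0 B : B \in P -> 0 < #|B|.
  by move=> PB; rewrite card_gt0; apply: contraNneq P0 => <-.
have leif : #|P| <= #|[set: T]| ?= iff [forall (B | B \in P), 1%N == #|B|].
  rewrite (card_partition partP) -sum1_card.
  by apply: leqif_sum => B PB; split; first exact: Bgt0.
have -> : (1 < #|P|) = (P != [set [set: T]]).
  have [-> | /= neP] := eqVneq P [set [set: T]]; first by rewrite cards1.
  rewrite ltn_neqAle card_gt0 eq_sym; apply/andP; split.
    apply: contra neP => /cards1P[B defP].
    by rewrite -covP defP /cover big_set1.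
  by apply: contraTneq T_gt0 => P_0; rewrite -cardsT -covP P_0 /cover big_set0 cards0.
rewrite /trivial_partition negb_or andbC; congr (_ && _).
rewrite ltn_neqAle leif.1 leif.2 andbT; congr (~~ _).
apply/eqP/forall_inP => [-> B /imsetP[x _ ->] | P1]; first by rewrite cards1.
apply/setP=> B; apply/idP/imsetP => [PB | [x _ ->]].
  have /cards1P[x ->] : #|B| == 1%N by rewrite eq_sym P1.
  by exists x.
have /bigcupP[C PC Cx] : x \in cover P by rewrite covP inE.
have /cards1P[y defC] : #|C| == 1%N by rewrite eq_sym P1.
by move: Cx PC; rewrite defC => /set1P->.
Qed.

Lemma imprimitive_groupE :
  imprimitive_group <-> transitive_group /\ ~~ primitive G [set: T] 'P.
Proof.
rewrite /imprimitive_group /primitive; case: (boolP transitive_group); last first.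
  by move=> ntrG; split=> -[].
move=> trG; rewrite (trG : [transitive G, on [set: T] | 'P]) /= negbK.
have T_gt0 : 0 < #|T| by case/imsetP: trG => x _ _; apply/card_gt0P; exists x.
split=> -[_]; last case/existsP=> P /and3P[partP invP ltP].
  case=> P [partP invP ntP]; split=> //; apply/existsP; exists P.
  by rewrite /imprimitivity_system partP -nontrivial_partitionE // ntP andbT.
by split=> //; exists P; split; rewrite ?nontrivial_partitionE.
Qed.

End PermutationGroups.

Definition perm_isomorphic (T U : finType)
    (G : {group {perm T}}) (H : {group {perm U}}) : Prop :=
  exists (f : T -> U) (phi : {morphism G >-> {perm U}}),
    [/\ bijective f, isom G H phi
      & forall x g, g \in G -> f (g x) = phi g (f x)].

(* The Klein group is the product of two copies of the additive group of Z/2;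
   klein_regular is its image under the right regular representation. *)
Definition klein : finGroupType := ('Z_2 * 'Z_2)%type.

Definition klein_regular : {group {perm klein}} :=
  (actperm_morphism 'R @* [set: klein])%G.

(* Main.v *)
Require Import Defs.
From mathcomp Require Import all_boot all_fingroup ssralg zmodp primitive_action.
From mathcomp Require Import pgroup abelian.

(** Let P be a non-trivial G-invariant partition and B one of its blocks.  The
    translates of B are exactly the blocks of P, so every partition into
    sections of P is section-regular, witnessed by B, and therefore
    G-invariant.  Such partitions are the fibres of labellings: functions f
    that are injective on every block and take the same values on all of them.
    Thus f x = f y implies f (g x) = f (g y) for every labelling f
    ([labelling_invariant]), and labellings are plentiful, since composing one
    with a permutation that preserves each block gives another.

    This abundance makes P tiny.  Take x and y in different blocks and a
    labelling f with f x = f y.  If u and v are distinct points of one block,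
    both different from x and y, then swapping the labels of u and v changes
    the fibre through u but not the one through x, although an element of G
    that maps x to u must carry the latter fibre to the former in both
    labellings.  So x and y together meet every pair of points inside a block
    ([two_points_meet_pairs]), which leaves exactly two blocks of size two.

    With two blocks, a fibre of a labelling through x is a pair {x, y}, where
    y may be any point of the other block; each such pair is a block of
    imprimitivity ([cross_pair_block]).  Hence an element fixing one point
    fixes every point of the other block, and then every point, so that G is
    regular of order 4.  Moreover an element moving x to y moves y back to x,
    whether y lies in the block of x or not; G therefore has exponent 2 and is
    elementary abelian of order 4.  A regular group is permutation isomorphic
    to the right regular representation of its isomorphism type
    ([regular_perm_isomorphic]). *)

Set Implicit Arguments.
Unset Strict Implicit.
Unset Printing Implicit Defensive.

Import GroupScope.

(** * Labellings of a block system *)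

Section BlockSystem.

Variables (T : finType) (G : {group {perm T}}) (P : {set {set T}}).
Hypotheses (trG : transitive_group G) (partP : partition P [set: T]).
Hypothesis invP : invariant_partition G P.

Local Notation block := (pblock P).

Lemma transitive_groupP x y : exists2 g : {perm T}, g \in G & g x = y.
Proof.
have /orbitP[g Gg <-] : y \in orbit 'P G x by rewrite (atransP trG) ?inE.
by exists g.
Qed.

Let triv : trivIset P. Proof. by case/and3P: partP. Qed.
Let cov x : x \in cover P. Proof. by rewrite (cover_partition partP) inE. Qed.
Let mem_block x y : (y \in block x) = (block x == block y).
Proof. by rewrite eq_pblock. Qed.

Lemma block_perm (g : {perm T}) x : g \in G -> block (g x) = g @: block x.
Proof.
move=> Gg; apply: def_pblock => //; last by rewrite imset_f // mem_pblock.
exact: etrans (acts_act invP Gg (block x)) (pblock_mem (cov x)).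
Qed.

Lemma block_permK (g : {perm T}) x y :
  g \in G -> (block (g x) == block (g y)) = (block x == block y).
Proof.
by move=> Gg; rewrite !block_perm // (inj_eq (imset_inj (@perm_inj _ g))).
Qed.

(** The fibres of f form a partition orthogonal to P: each fibre meets each
    block exactly once. *)
Definition labelling (f : T -> nat) : Prop :=
  (forall x y, block x = block y -> f x = f y -> x = y) /\
  (forall x y, exists2 z, block z = block y & f z = f x).

(** Blocks are equicardinal by transitivity, so numbering the points of each
    block independently gives all blocks the same set of labels. *)
Lemma labelling_exists : exists f, labelling f.
Proof.
pose f x := index x (enum (block x)); exists f.
split=> [x y Exy|x y].
  by rewrite /f Exy => /(index_inj x); apply; rewrite mem_enum mem_block ?Exy.
have [g Gg gx] := transitive_groupP x y.
have card_xy : #|block x| = #|block y|.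
  by rewrite -gx block_perm // card_imset //; apply: perm_inj.
have lt_fx : f x < size (enum (block y)).
  by rewrite -cardE -card_xy cardE index_mem mem_enum mem_block.
pose z := nth x (enum (block y)) (f x).
have Ez : block z = block y.
  by apply/esym/eqP; rewrite -mem_block -mem_enum mem_nth.
by exists z => //; rewrite {1}/f Ez index_uniq // enum_uniq.
Qed.

Lemma labelling_tperm f u v :
  labelling f -> block u = block v -> labelling (f \o tperm u v).
Proof.
move=> [injf surjf] Euv.
have blockt x : block (tperm u v x) = block x by case: tpermP => // ->.
split=> [x y Exy /= /injf|x y].
  by rewrite !blockt => /(_ Exy)/perm_inj.
have [z Ez fz] := surjf (tperm u v x) y.
by exists (tperm u v z); rewrite ?blockt //= tpermK.
Qed.

(** Any labelling can be corrected by one transposition inside the block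
    of y. *)
Lemma labelling_align x y :
  block x != block y -> exists2 f, labelling f & f x = f y.
Proof.
move=> nExy; have [f labf] := labelling_exists.
have [_ /(_ x y)[z Ez fz]] := labf.
exists (f \o tperm y z); first exact: labelling_tperm.
rewrite /= tpermL fz tpermD //; first by apply: contraNneq nExy => ->.
by apply: contraNneq nExy => <-; rewrite Ez.
Qed.

(** * Consequences of pre-synchronization *)

Hypothesis psG : pre_synchronizing G.

(** This is the only use of pre-synchronization: a block of P is mapped by G to
    blocks of P, each of which is a section of the partition into fibres, so
    the latter partition is section-regular and hence invariant. *)
Lemma labelling_invariant f (g : {perm T}) x y :
  labelling f -> g \in G -> f x = f y -> f (g x) = f (g y).
Proof.
move=> [injf surjf] Gg fxy.
pose Q := preim_partition f [set: T].
have partQ : partition Q [set: T] by apply: preim_partitionP.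
have Q_eq a c : (c \in pblock Q a) = (f a == f c).
  rewrite pblock_equivalence_partition ?inE //.
  by move=> a1 a2 a3 _ _ _; split=> // /eqP->.
have /and3P[_ trQ _] := partQ.
have covQ a : a \in cover Q by rewrite (cover_partition partQ) inE.
have srQ : section_regular G Q.
  exists (block x) => h Gh; rewrite -block_perm //.
  rewrite /is_transversal partQ subsetT /=; apply/forall_inP=> B QB.
  have [a _ ->] := imsetP QB.
  have [z Ez fz] := surjf a (h x).
  rewrite (_ : _ :&: _ = [set z]) ?cards1 //.
  apply/setP=> c; rewrite !inE mem_block -Ez -fz.
  apply/andP/eqP=> [[/eqP Ezc /eqP fzc]|->]; last by rewrite !eqxx.
  exact/esym/injf.
have invQ := psG.2 Q partQ srQ.
have QJ : g @: pblock Q x \in Q.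
  exact: etrans (acts_act invQ Gg (pblock Q x)) (pblock_mem (covQ x)).
apply/eqP; rewrite -Q_eq (def_pblock trQ QJ) ?imset_f // Q_eq ?fxy //.
Qed.

(** Suppose u and v both avoid x and y, let f x = f y, and let g map x to u.
    Invariance gives f (g y) = f u.  Swapping the labels of u and v leaves
    those of x, y and g y unchanged, so it also gives f (g y) = f v, against
    the injectivity of f on the block of u. *)
Lemma two_points_meet_pairs x y u v :
    block x != block y -> block u = block v -> u != v ->
  [|| u == x, u == y, v == x | v == y].
Proof.
move=> nExy Euv; apply: contraR; rewrite !negb_or => /and4P[ux uy vx vy].
have [f labf fxy] := labelling_align nExy.
have [g Gg gx] := transitive_groupP x u.
have nEu : block (g y) != block u by rewrite -gx eq_sym block_permK.
have fgy : f u = f (g y) by rewrite -gx; apply: labelling_invariant fxy.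
have ugy : u != g y by apply: contraNneq nEu => <-.
have vgy : v != g y by apply: contraNneq nEu => <-; rewrite Euv.
have := labelling_invariant (labelling_tperm labf Euv) Gg (x := x) (y := y).
rewrite /= gx tpermL !tpermD // => /(_ fxy) fv.
by apply/eqP/labf.1; rewrite // fgy.
Qed.

Hypothesis ntP : ~~ trivial_partition P.

Lemma block_nontrivial x : exists2 x', x' != x & block x' = block x.
Proof.
have T_gt0 : 0 < #|T| by apply/card_gt0P; exists x.
have /andP[_ ltPT] : 1 < #|P| < #|[set: T]| by rewrite -nontrivial_partitionE.
have /injectivePn[u [v nuv Euv]] : ~~ injectiveb (fun z => block z).
  apply: contraL ltPT => /injectiveP injb; rewrite -leqNgt cardsT.
  rewrite -(card_imset predT injb); apply/subset_leq_card/subsetP=> B.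
  by case/imsetP=> z _ ->; apply: pblock_mem.
have [g Gg <-] := transitive_groupP u x.
exists (g v); first by rewrite (inj_eq perm_inj) eq_sym.
by apply/eqP; rewrite block_permK // Euv.
Qed.

Lemma block_proper x : exists y, block x != block y.
Proof.
have T_gt0 : 0 < #|T| by apply/card_gt0P; exists x.
have /andP[P_gt1 _] : 1 < #|P| < #|[set: T]| by rewrite -nontrivial_partitionE.
have /subsetPn[B PB nB] : ~~ (P \subset [set block x]).
  by apply: contraL P_gt1 => /subset_leq_card; rewrite cards1 -leqNgt.
have /set0Pn[y By] : B != set0.
  by case/and3P: partP => _ _; apply: contraNneq => <-.
exists y; apply: contraNneq nB => Exy.
by rewrite inE Exy (def_pblock triv PB By).
Qed.

(** A third block would contain a pair of points away from x and y. *)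
Lemma two_blocks x y z :
  block x != block y -> (block z == block x) || (block z == block y).
Proof.
move=> nExy; have [z' nz Ez] := block_nontrivial z.
have := two_points_meet_pairs nExy Ez nz.
by case/or4P=> /eqP <-; rewrite ?Ez eqxx ?orbT.
Qed.

(** There are two blocks, and a block has two points: a pair inside the block
    of x that avoids x would also avoid y. *)
Lemma card_points : #|T| = 4.
Proof.
have [x _ _] := imsetP trG.
have [y nExy] := block_proper x.
have [x' nx Ex] := block_nontrivial x; have [y' ny Ey] := block_nontrivial y.
have cover2 u v u' z : block u != block v -> u' != u -> block u' = block u ->
    block z = block u -> (z == u) || (z == u').
  move=> nEuv nu Eu Ez; have := two_points_meet_pairs nEuv (etrans Ez (esym Eu)).
  have /negPf nzv : z != v by apply: contraNneq nEuv => <-; rewrite Ez.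
  have /negPf nuv : u' != v by apply: contraNneq nEuv => <-; rewrite Eu.
  by rewrite nzv nuv (negPf nu) /= orbF eq_sym; case: eqP => [|_ ->]; rewrite ?orbT.
have n_xy u v : block u = block x -> block v = block y -> u != v.
  by move=> Eu Ev; apply: contraNneq nExy => E; rewrite -Eu -Ev E.
have uniq4 : uniq [:: x; x'; y; y'].
  rewrite /= !inE !negb_or (eq_sym x x') (eq_sym y y') nx ny.
  by rewrite (n_xy x y) ?(n_xy x y') ?(n_xy x' y) ?(n_xy x' y').
rewrite -[4](card_uniqP uniq4); apply: eq_card => z; rewrite !inE.
case/orP: (two_blocks z nExy) => /eqP Ez.
  by case/orP: (cover2 _ _ _ _ nExy nx Ex Ez) => ->; rewrite ?orbT.
have nEyx : block y != block x by rewrite eq_sym.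
by case/orP: (cover2 _ _ _ _ nEyx ny Ey Ez) => ->; rewrite ?orbT.
Qed.

(** As there are only two blocks, {x, y} is a whole fibre of any labelling
    with f x = f y, and fibres are permuted by G. *)
Lemma cross_pair_block (g : {perm T}) x y :
    block x != block y -> g \in G -> g x \in [set x; y] ->
  g y \in [set x; y].
Proof.
move=> nExy Gg gx; have [f labf fxy] := labelling_align nExy.
have fgy : f (g y) = f x.
  rewrite -(labelling_invariant labf Gg fxy).
  by case/set2P: gx => ->.
rewrite !inE; case/orP: (two_blocks (g y) nExy) => /eqP Egy; apply/orP.
  by left; apply/eqP; apply: labf.1.
by right; apply/eqP; apply: labf.1; rewrite // fgy.
Qed.

(** A fixed point forces all points of the other block to be fixed, and these
    in turn force the points of its own block. *)
Lemma stabilizer_trivial (g : {perm T}) x : g \in G -> g x = x -> g = 1.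
Proof.
move=> Gg gx; have fix_cross u v : block u != block v -> g u = u -> g v = v.
  move=> nEuv gu; have := cross_pair_block nEuv Gg; rewrite gu set21.
  case/(_ isT)/set2P=> // gv; have /perm_inj vu : g v = g u by rewrite gv gu.
  by rewrite vu eqxx in nEuv.
have [y nExy] := block_proper x; have gy := fix_cross _ _ nExy gx.
apply/permP=> z; rewrite perm1; have [Exz|nExz] := eqVneq (block x) (block z).
  by apply: (fix_cross y) => //; rewrite -Exz eq_sym.
exact: fix_cross gx.
Qed.

(** By regularity it is enough that g swaps x and g x.  If g x lies in the other
    block, {x, g x} is permuted by g.  Otherwise the pair {g x, g (g x)} lies
    in the block of x, and by [two_points_meet_pairs] it contains x. *)
Lemma squares_trivial (g : {perm T}) : g \in G -> (g ^+ 2 = 1).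
Proof.
move=> Gg; have [x _ _] := imsetP trG.
apply: (@stabilizer_trivial _ x); first exact: groupX.
rewrite expgS expg1 permM; have [Egx|nEgx] := eqVneq (block x) (block (g x)).
  have [gx|gx] := eqVneq (g x) x; first by rewrite !gx.
  have [y nExy] := block_proper x.
  have Eggx : block (g x) = block (g (g x)) by apply/eqP; rewrite block_permK ?Egx.
  have ggx : g x != g (g x) by rewrite (inj_eq perm_inj) eq_sym.
  have := two_points_meet_pairs nExy Eggx ggx.
  rewrite (negPf gx) /= => /or3P[] /eqP // E; case/eqP: nExy.
    by rewrite Egx E.
  by rewrite Egx Eggx E.
have := cross_pair_block nEgx Gg; rewrite set22 => /(_ isT)/set2P[] // E.
by case/eqP: nEgx; rewrite (perm_inj E).
Qed.

Lemma card_group : #|G| = 4.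
Proof.
have [x _ _] := imsetP trG.
rewrite -(card_orbit_stab 'P G x) (atransP trG) ?inE // cardsT card_points.
rewrite (_ : 'C_G[x | 'P] = 1) ?cards1 //; apply/eqP; rewrite -subG1.
apply/subsetP=> g /setIP[Gg /astab1P gx]; rewrite inE.
by apply/eqP/(@stabilizer_trivial _ x).
Qed.

End BlockSystem.

(** * Regular permutation groups *)

(** Fixing a base point x0 identifies each point x with the unique h x in G
    that maps x0 to x; under x |-> h x the action of G becomes right
    multiplication. *)
Lemma regular_perm_isomorphic (T : finType) (G : {group {perm T}})
    (K : finGroupType) :
    transitive_group G ->
    (forall (g : {perm T}) x, g \in G -> g x = x -> g = 1) ->
    G \isog [set: K] ->
  perm_isomorphic G (actperm_morphism 'R @* [set: K])%G.
Proof.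
move=> trG freeG /isog_isom[psi /isomP[inj_psi im_psi]].
have [x0 _ _] := imsetP trG.
have reach x : exists g : {perm T}, (g \in G) && (g x0 == x).
  by have [g Gg <-] := transitive_groupP trG x0 x; exists g; rewrite Gg eqxx.
pose h x := xchoose (reach x).
have hG x : h x \in G by case/andP: (xchooseP (reach x)).
have hE x : h x x0 = x by case/andP: (xchooseP (reach x)) => _ /eqP.
have h_uniq g : g \in G -> h (g x0) = g.
  move=> Gg; apply/eqP; rewrite eq_mulgV1; apply/eqP/(freeG _ x0).
    by rewrite groupM ?groupV.
  by rewrite permM hE permK.
have inKG k : k \in psi @* G by rewrite im_psi inE.
have morph_phi :
    {in G &, {morph (fun g => actperm 'R (psi g)) : g1 g2 / g1 * g2}}.
  by move=> g1 g2 G1 G2; rewrite /= !morphM ?inE.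
exists (fun x => psi (h x)), (Morphism morph_phi); split.
- exists (fun k => invm inj_psi k x0) => [x|k].
    by rewrite invmE.
  rewrite h_uniq ?invmK // -(im_invm inj_psi).
  by rewrite mem_morphim ?inKG.
- apply/isomP; split.
    (* Right multiplication by a is determined by its value a at 1. *)
    apply/injmP=> g1 g2 G1 G2 /= /permP/(_ 1).
    by rewrite !actpermE /= !mul1g => /(injmP inj_psi) ->.
  apply/setP=> s; apply/morphimP/morphimP=> [[g _ Gg ->]|[k _ _ ->]].
    by exists (psi g); rewrite ?inE.
  have /morphimP[g _ Gg ->] := inKG k; by exists g.
move=> x g Gg; rewrite /= actpermE /= -morphM //; congr (psi _).
by rewrite -(h_uniq (h x * g)) ?groupM // permM hE.
Qed.

(** * The Klein group *)

Theorem theorem5p1 (T : finType) (G : {group {perm T}}) :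
  imprimitive_group G -> pre_synchronizing G ->
  #|T| = 4 /\ perm_isomorphic G klein_regular.
Proof.
move=> [trG [P [partP invP ntP]]] psG.
have cardT := card_points trG partP invP psG ntP; split=> //.
apply: regular_perm_isomorphic => //; first exact: stabilizer_trivial ntP.
have cardK : #|[set: klein]| = 4 by rewrite cardsT card_prod !card_ord.
have abK : 2.-abelem [set: klein].
  apply/exponent2_abelem/exponentP=> -[a b] _.
  by case: a => [[|[|//]] ?]; case: b => [[|[|//]] ?]; apply/eqP.
rewrite (isog_abelem_card _ (p := 2)) ?abK ?cardK.
  by rewrite (card_group trG partP invP psG ntP).
apply/exponent2_abelem/exponentP; exact: squares_trivial ntP.
Qed.
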